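(* Let $n\ge2$ and let $\mathfrak{b}=\{h_1,\ldots,h_n\}$ be a basis for a group $H$, with associated subgroups $H_i=C_H(h_i)$ $(1\le i\le n)$ and $H_{ij}=[H_i,H_j]$ $(1\le i<j\le n)$. Then the subgroups $Z(H)$, $H_i$ $(1\le i\le n)$, $H_{ij}$ $(1\le i<j\le n)$ and $[H,H]$ are first-order definable in the enriched group $(H,\mathfrak{b})=(H,h_1,\ldots,h_n)$. Consequently, all the conditions (1)–(5) in the definition of a basis can be expressed by first-order formulas of the signature of groups enriched by $n$ constant symbols for $h_1,\ldots,h_n$; moreover, the additional condition making a basis $\mathfrak{b}$ a $P(f_H)$-basis is also expressible by a first-order sentence of this enriched signature.
   Context: Commutators: $[x,y]=x^{-1}y^{-1}xy$; $[A,B]$ is the subgroup generated by all $[a,b]$, $a\in A,b\in B$ (and $[h,B]=[\{h\},B]$). Basis. Let $H$ be a group with distinct nontrivial elements $h_1,\ldots,h_n$. Then $\{h_1,\ldots,h_n\}$ is a basis for $H$ if there are subgroups $H_i$ ($1\le i\le n$), $H_{ij}$ ($1\le i<j\le n$) of $H$ with: (1) $H_i=C_H(h_i)$ and $H_{ij}=[h_i,H_j]=[H_i,h_j]=[H_i,H_j]$ for $i<j$; (2) $H_i\cap H_j=Z(H)$ for $i<j$; (3) $[H_i,H_i]=1$; (4) $[H,H]\subseteq Z(H)$; (5)(a) every element of $H$ can be written as $u_nu_{n-1}\cdots u_1v$ with $u_i\in H_i$, $v\in Z(H)$, and each $u_i$ is unique modulo $Z(H)$; (5)(b) each $v\in Z(H)$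 can be uniquely written as $u_{12}\cdots u_{1n}u_{23}\cdots u_{n-1,n}$ with $u_{ij}\in H_{ij}$. (In this case $Z(H)=[H,H]$.) For such $H$, $f_H:H/Z(H)\times H/Z(H)\to Z(H)$ is the bilinear map $(xZ(H),yZ(H))\mapsto[x,y]$, and $P(f_H)$ is the commutative associative unital ring of all pairs $(\phi_1,\phi_0)\in \mathrm{End}(H/Z(H))\times\mathrm{End}(Z(H))$ satisfying $f_H(\phi_1(u),w)=f_H(u,\phi_1(w))=\phi_0(f_H(u,w))$ for all $u,w\in H/Z(H)$, with coordinatewise addition and composition; it acts on $H/Z(H)$ via $\phi_1$ and on $Z(H)$ via $\phi_0$. $P(f_H)$-basis. $\{h_1,\ldots,h_n\}$ is a $P(f_H)$-basis for $H$ if it is a basis for $H$ and, for every $i$, $H_i/Z(H)$ is a cyclic $P(f_H)$-module generated by $h_iZ(H)$ (this is the ''additional condition''). ''Expressible'' means that there are first-order sentences of the enriched signature, depending only on $n$, such that a tuple $(h_1,\ldots,h_n)$ of distinct nontrivial elements of a group $H$ is a basis (respectively, a basis of $H$ is a $P(f_H)$-basis) if and only if $(H,h_1,\ldots,h_n)$ satisfies these sentences. *)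

(* Defs.v *)
From HB Require Import structures.
From mathcomp Require Import all_boot.
From mathcomp Require Import boolp classical_sets.

Set Implicit Arguments.
Unset Strict Implicit.
Unset Printing Implicit Defensive.

Local Open Scope classical_set_scope.
Local Open Scope group_scope.
Local Open Scope quotient_scope.

(* First-order logic in the signature of groups enriched by n constants. The
   index k counts the variables in scope, so a formula in [formula n k] has its
   free variables among k; binders add variable 0 and shift the others. *)

Inductive term (n k : nat) : Type :=
| tVar of 'I_k
| tConst of 'I_n
| tOne
| tMul of term n k & term n k
| tInv of term n k.

Inductive formula (n : nat) : nat -> Type :=
| fEq k of term n k & term n k : formula n k
| fFalse k : formula n k
| fNot k of formula n k : formula n k
| fAnd k of formula n k & formula n k : formula n k
| fOr k of formula n k & formula n k : formula n k
| fImp k of formula n k & formula n k : formula n k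
| fAll k of formula n k.+1 : formula n k
| fEx k of formula n k.+1 : formula n k.

Notation sentence n := (formula n 0).

Definition econs (T : Type) (k : nat) (x : T) (e : 'I_k -> T) : 'I_k.+1 -> T :=
  fun i => if unlift ord0 i is Some j then e j else x.

Definition enil (T : Type) : 'I_0 -> T :=
  fun i => False_rect T (notF (ltn_ord i)).

Section Semantics.
Variables (n : nat) (H : groupType) (h : 'I_n -> H).

Fixpoint eval k (e : 'I_k -> H) (t : term n k) : H :=
  match t with
  | tVar i => e i
  | tConst i => h i
  | tOne => 1
  | tMul t1 t2 => eval e t1 * eval e t2
  | tInv t1 => (eval e t1)^-1
  end.

Fixpoint sat k (f : formula n k) : ('I_k -> H) -> Prop :=
  match f with
  | fEq _ t1 t2 => fun e => eval e t1 = eval e t2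
  | fFalse _ => fun=> False
  | fNot _ f1 => fun e => ~ sat f1 e
  | fAnd _ f1 f2 => fun e => sat f1 e /\ sat f2 e
  | fOr _ f1 f2 => fun e => sat f1 e \/ sat f2 e
  | fImp _ f1 f2 => fun e => sat f1 e -> sat f2 e
  | fAll _ f1 => fun e => forall x, sat f1 (econs x e)
  | fEx _ f1 => fun e => exists x, sat f1 (econs x e)
  end.

Definition models (s : sentence n) : Prop := sat s (@enil H).

Definition models_all (Sigma : seq (sentence n)) : Prop :=
  foldr (fun s P => models s /\ P) True Sigma.

Definition defined_by (f : formula n 1) : set H :=
  [set x | sat f (fun=> x)].

End Semantics.

Section Subgroups.
Variable H : groupType.

Definition is_subgroup (K : set H) : Prop :=
  K 1 /\ forall x y, K x -> K y -> K (x / y).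

Definition center : set H := [set z | forall x, commute z x].

Definition centralizer (h : H) : set H := [set x | commute h x].

(* [~ a, b] is a^-1 * b^-1 * a * b *)
Definition commutator (A B : set H) : set H :=
  smallest is_subgroup [set [~ a, b] | a in A & b in B].

End Subgroups.

Arguments center H : clear implicits.

Definition nil2 (H : groupType) : Prop :=
  commutator [set: H] [set: H] `<=` center H.

Section Basis.
Variables (n : nat) (H : groupType) (h : 'I_n -> H).

(* [u i j] is only meaningful for i < j; the product is in lexicographic order *)
Definition upper_prod (u : 'I_n -> 'I_n -> H) : H :=
  \prod_(i < n) \prod_(j < n | i < j) u i j.

(* u_(n-1) * ... * u_0 *)
Definition rev_prod (u : 'I_n -> H) : H := \prod_(i < n) u (rev_ord i).

Record basis_conditions (S : 'I_n -> set H) (S2 : 'I_n -> 'I_n -> set H) :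
    Prop := BasisConditions {
  basis_subgroup : forall i, is_subgroup (S i);
  basis_subgroup2 : forall i j : 'I_n, i < j -> is_subgroup (S2 i j);
  basis_cent : forall i, S i = centralizer (h i);
  basis_comml : forall i j : 'I_n, i < j ->
    S2 i j = commutator [set h i] (S j);
  basis_commr : forall i j : 'I_n, i < j ->
    S2 i j = commutator (S i) [set h j];
  basis_comm : forall i j : 'I_n, i < j -> S2 i j = commutator (S i) (S j);
  basis_capI : forall i j : 'I_n, i < j -> S i `&` S j = center H;
  basis_abelian : forall i, commutator (S i) (S i) = [set 1];
  basis_class2 : nil2 H;
  basis_decomp : forall x : H,
    exists u v, [/\ forall i, S i (u i), center H v & x = rev_prod u * v];
  basis_decomp_uniq : forall u u' v v',
    (forall i, S i (u i)) -> (forall i, S i (u' i)) ->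
    center H v -> center H v' ->
    rev_prod u * v = rev_prod u' * v' ->
    forall i, center H ((u i)^-1 * u' i);
  basis_decomp2 : forall v, center H v -> exists u,
    (forall i j : 'I_n, i < j -> S2 i j (u i j)) /\ v = upper_prod u;
  basis_decomp2_uniq : forall v, center H v -> forall u u',
    (forall i j : 'I_n, i < j -> S2 i j (u i j)) ->
    (forall i j : 'I_n, i < j -> S2 i j (u' i j)) ->
    v = upper_prod u -> v = upper_prod u' ->
    forall i j : 'I_n, i < j -> u i j = u' i j
}.

Definition distinct_nontrivial : Prop := injective h /\ forall i, h i <> 1.

Definition is_basis : Prop :=
  distinct_nontrivial /\ exists S S2, basis_conditions S S2.

Lemma basis_nil2 : is_basis -> nil2 H.
Proof. by case=> _ [S [S2 b]]; exact: basis_class2 b. Qed.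

End Basis.

(* The groups Z(H) and H/Z(H) *)

Section CenterQuotient.
Variable H : groupType.

Lemma center_closed : group_closed (fun x : H => x \in center H).
Proof.
split=> [|x y]; first by rewrite inE => z; rewrite /commute mul1g mulg1.
rewrite !inE => xZ yZ z.
have Vy : commute y^-1 z by apply/commute_sym/commuteV/commute_sym/yZ.
by rewrite /commute -mulgA Vy mulgA xZ mulgA.
Qed.

Definition center_of : Type := {x : H | x \in center H}.

HB.instance Definition _ := SubChoice.on center_of.
HB.instance Definition _ :=
  SubChoice_isSubGroup.Build H (fun x => x \in center H) center_of
    center_closed.

Lemma center1 : center H 1.
Proof. by case: center_closed; rewrite inE. Qed.

Lemma centerF x y : center H x -> center H y -> center H (x / y).
Proof. by case: center_closed => _ /(_ x y); rewrite !inE. Qed.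

Lemma centerV x : center H x -> center H x^-1.
Proof. by move=> /(centerF center1); rewrite div1g. Qed.

Lemma centerM x y : center H x -> center H y -> center H (x * y).
Proof. by move=> xZ /centerV /(centerF xZ); rewrite invgK. Qed.

Lemma centerJ x y : center H x -> x ^ y = x.
Proof. by move=> xZ; rewrite conjgE xZ mulKg. Qed.

Definition center_rel (x y : H) : bool := x^-1 * y \in center H.

Lemma center_rel_refl : reflexive center_rel.
Proof. by move=> x; rewrite /center_rel mulVg inE; exact: center1. Qed.

Lemma center_rel_sym : symmetric center_rel.
Proof.
by move=> x y; apply/idP/idP; rewrite /center_rel !inE => /centerV;
   rewrite invgM invgK.
Qed.

Lemma center_rel_trans : transitive center_rel.
Proof.
move=> y x z; rewrite /center_rel !inE => xy yz.
by have := centerM xy yz; rewrite -mulgA mulVKg.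
Qed.

Canonical center_equiv :=
  EquivRel center_rel center_rel_refl center_rel_sym center_rel_trans.

Definition center_quot : Type := {eq_quot center_equiv}.

HB.instance Definition _ := Choice.on center_quot.
HB.instance Definition _ := EqQuotient.on center_quot.

Definition coset (x : H) : center_quot := \pi_center_quot x.

Lemma center_quotP (x y : H) :
  coset x = coset y <-> center H (x^-1 * y).
Proof.
split=> [/eqmodP|xy]; first by rewrite /= /center_rel inE.
by apply/eqmodP; rewrite /= /center_rel inE.
Qed.

Lemma cosetW (P : center_quot -> Prop) :
  (forall x, P (coset x)) -> forall u, P u.
Proof. by move=> Px u; rewrite -[u]reprK; exact: Px. Qed.

Lemma repr_center_quot (x : H) :
  exists2 z, center H z & repr (coset x) = x * z.
Proof.
exists (x^-1 * repr (coset x)); last by rewrite mulVKg.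
by apply/center_quotP; rewrite /coset reprK.
Qed.

Definition quot_mul (u w : center_quot) : center_quot :=
  coset (repr u * repr w).
Definition quot_inv (u : center_quot) : center_quot := coset (repr u)^-1.
Definition quot_one : center_quot := coset 1.

Lemma quot_mulE x y : quot_mul (coset x) (coset y) = coset (x * y).
Proof.
have [z zZ ez] := repr_center_quot x; have [t tZ et] := repr_center_quot y.
rewrite /quot_mul ez et; apply/center_quotP.
have -> : x * z * (y * t) = x * y * (z * t)
  by rewrite -!mulgA (mulgA z) (zZ y) -!mulgA.
by rewrite invgM -mulgA mulVg mulg1; apply/centerV/centerM.
Qed.

Lemma quot_invE x : quot_inv (coset x) = coset x^-1.
Proof.
have [z zZ e] := repr_center_quot x; rewrite /quot_inv e.
by apply/center_quotP; rewrite invgK -mulgA zZ mulVKg.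
Qed.

Lemma quot_mulA : associative quot_mul.
Proof.
elim/cosetW=> x; elim/cosetW=> y; elim/cosetW=> z.
by rewrite !quot_mulE mulgA.
Qed.

Lemma quot_mul1 : left_id quot_one quot_mul.
Proof. by elim/cosetW=> x; rewrite quot_mulE mul1g. Qed.

Lemma quot_mulr1 : right_id quot_one quot_mul.
Proof. by elim/cosetW=> x; rewrite quot_mulE mulg1. Qed.

Lemma quot_mulV : left_inverse quot_one quot_inv quot_mul.
Proof. by elim/cosetW=> x; rewrite quot_invE quot_mulE mulVg. Qed.

Lemma quot_mulrV : right_inverse quot_one quot_inv quot_mul.
Proof. by elim/cosetW=> x; rewrite quot_invE quot_mulE mulgV. Qed.

HB.instance Definition _ := isGroup.Build center_quot
  quot_mulA quot_mul1 quot_mulr1 quot_mulV quot_mulrV.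

Lemma cosetM : {morph coset : x y / x * y}.
Proof. by move=> x y; rewrite -quot_mulE. Qed.

Variable cl2 : nil2 H.

Lemma commg_center (x y : H) : [~ x, y] \in center H.
Proof.
by rewrite inE; apply: cl2 => K [_ sub]; apply: sub; exists x => //; exists y.
Qed.

Definition f_H (u w : center_quot) : center_of :=
  exist _ [~ repr u, repr w] (commg_center (repr u) (repr w)).

Lemma f_HE x y : val (f_H (coset x) (coset y)) = [~ x, y].
Proof.
rewrite /=.
have [z zZ ->] := repr_center_quot x; have [t tZ ->] := repr_center_quot y.
have eJ a b c : center H c -> a ^ (b * c) = a ^ b.
  by move=> cZ; rewrite conjgM [LHS]conjgE -(cZ (a ^ b)) mulKg.
rewrite !commgEl eJ // conjMg (centerJ _ zZ) invgM -mulgA.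
by rewrite (mulgA x^-1) -(zZ (x^-1 * x ^ y)) mulKg.
Qed.

Definition P_f : set ({multiplicative center_quot -> center_quot} *
                      {multiplicative center_of -> center_of}) :=
  fun phi => forall u w,
    f_H (phi.1 u) w = f_H u (phi.1 w) /\
    f_H u (phi.1 w) = phi.2 (f_H u w).

(* P_f is a unital ring under pointwise addition and composition, so the
   submodule generated by m is the orbit of m. *)
Definition P_f_cyclic (m : center_quot) : set center_quot :=
  [set v | exists2 phi, P_f phi & phi.1 m = v].

End CenterQuotient.

Section PfBasis.
Variables (n : nat) (H : groupType) (h : 'I_n -> H).

(* In a basis the subgroup H_i is the centralizer of h_i *)
Definition is_P_f_basis : Prop :=
  exists b : is_basis h, forall i,
    [set coset x | x in centralizer (h i)] =
    P_f_cyclic (basis_nil2 b) (coset (h i)).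

End PfBasis.

(* One formula, depending only on n, must define S in every (H, h). *)
Definition definable_in_bases (n : nat)
    (S : forall H : groupType, ('I_n -> H) -> set H) : Prop :=
  exists f : formula n 1, forall (H : groupType) (h : 'I_n -> H),
    is_basis h -> defined_by h f = S H h.

(* Main.v *)
From HB Require Import structures.
Require Import Defs.
From mathcomp Require Import all_boot.
From mathcomp Require Import boolp classical_sets.

Set Implicit Arguments.
Unset Strict Implicit.
Unset Printing Implicit Defensive.

Local Open Scope classical_set_scope.
Local Open Scope group_scope.

(** The centre and the centralizers are defined by formulas directly.  In a
group of class 2 the map c |-> [h_i, c] is a homomorphism, so [h_i, H_j] is
not only generated by the commutators [h_i, c] with c in H_j: it is the set of
them, and the formula quantifies over c ([commutator_set1l]).  In a basis this
subgroup is H_ij = [H_i, H_j], and [H, H] = Z(H) because every central element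
is a product of elements of the H_ij ([derived_center]).  Hence a basis can be
described with quantifiers over elements only ([basis_conditionsP]): H_i is
replaced by the centralizer of h_i, H_ij by a set of commutators, and the
equalities H_ij = [h_i, H_j] = [H_i, h_j] = [H_i, H_j] say that every [x, y]
with x in H_i and y in H_j has the form [h_i, c] and the form [c', h_j].

For the cyclicity of H_i/Z(H) over P(f_H), the point is that a pair
(phi_1, phi_0) is determined by the images y_k of the h_k: self-adjointness
gives [h_k, phi_1 w] = [y_k, w] for all k, and this system determines phi_1 w
modulo the centre, since two distinct centralizers meet in Z(H).  So the
graph of phi_1 is definable from the n-tuple y.  Conversely a tuple y comes
from P(f_H) as soon as this relation is total, sends h_k to y_k, and
[a, b] |-> [phi_1 a, b] is well defined on commutators ([multiplier]).  The
map phi_0 is then [h_k, c] |-> [y_k, c] on each H_kl, extended to Z(H) by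
the unique decomposition of central elements ([multiplier_center]), and
bilinearity reduces its compatibility with f_H to arguments taken in
some H_k and H_l, where it is the well-definedness again
([multiplier_P_f]).  A first-order sentence can quantify over the n entries
of y, so cyclicity is expressible ([cyclicity_axiomP]).

Formulas are never written out.  A family of relations, one on each enriched
group, is called first-order when some formula defines it uniformly; this
property is closed under the connectives and under quantification over
elements and over finite families of elements, and every statement above is
built in this way. *)

(** * Uniformly definable relations *)

Section Definability.
Variable n : nat.

Definition elem_family (V : Type) : Type :=
  forall H : groupType, ('I_n -> H) -> (V -> H) -> H.

Definition rel_family (V : Type) : Type :=
  forall H : groupType, ('I_n -> H) -> (V -> H) -> Prop.

(** The free variables V are any type, and the definition asks for a formula
after each substitution r of terms for them.  Building the substitution in
gives renaming and weakening for free, so no syntactic substitution in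
formulas is needed. *)
Definition is_term V (t : elem_family V) : Prop :=
  forall k (r : V -> term n k), exists s : term n k,
  forall (H : groupType) (h : 'I_n -> H) (e : 'I_k -> H),
    eval h e s = t H h (fun v => eval h e (r v)).

Definition first_order V (P : rel_family V) : Prop :=
  forall k (r : V -> term n k), exists f : formula n k,
  forall (H : groupType) (h : 'I_n -> H) (e : 'I_k -> H),
    sat h f e <-> P H h (fun v => eval h e (r v)).

Lemma fo_iff V (P Q : rel_family V) :
  (forall H h e, P H h e <-> Q H h e) -> first_order P -> first_order Q.
Proof.
by move=> PQ Pfo k r; have [f fP] := Pfo k r; exists f => H h e; rewrite fP.
Qed.

Lemma fo_rename V W (s : V -> W) (P : rel_family V) :
  first_order P ->
  first_order (fun H h (e : W -> H) => P H h (fun v => e (s v))).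
Proof. by move=> Pfo k r; have [f fP] := Pfo k (r \o s); exists f. Qed.

Section Terms.
Variable V : Type.

Lemma term_var (v : V) : is_term (fun H h e => e v).
Proof. by move=> k r; exists (r v). Qed.

Lemma term_const i : @is_term V (fun H h e => h i).
Proof. by move=> k r; exists (tConst k i). Qed.

Lemma term_mul (t u : elem_family V) :
  is_term t -> is_term u -> is_term (fun H h e => t H h e * u H h e).
Proof.
move=> tt tu k r; have [[s es] [s' es']] := (tt k r, tu k r).
by exists (tMul s s') => H h e /=; rewrite es es'.
Qed.

Lemma term_inv (t : elem_family V) :
  is_term t -> is_term (fun H h e => (t H h e)^-1).
Proof.
move=> tt k r; have [s es] := tt k r.
by exists (tInv s) => H h e /=; rewrite es.
Qed.

Lemma term_commg (t u : elem_family V) :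
  is_term t -> is_term u -> is_term (fun H h e => [~ t H h e, u H h e]).
Proof.
move=> tt tu; apply: (term_mul (term_inv tt)).
by apply: (term_mul (term_inv tu)); apply: term_mul.
Qed.

Lemma term_prod (I : Type) (s : seq I) (Q : pred I) (F : I -> elem_family V) :
  (forall i, is_term (F i)) ->
  is_term (fun H h e => \prod_(i <- s | Q i) F i H h e).
Proof.
move=> tF k r; elim: s => [|i s [p ep]].
  by exists (tOne n k) => H h e; rewrite big_nil.
have [q eq] := tF i k r.
exists (if Q i then tMul q p else p) => H h e; rewrite big_cons.
by case: (Q i); rewrite /= ?eq ep.
Qed.

End Terms.

Section Connectives.
Variable V : Type.
Implicit Types P Q R S : rel_family V.

Lemma fo_eq (t u : elem_family V) :
  is_term t -> is_term u -> first_order (fun H h e => t H h e = u H h e).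
Proof.
move=> tt tu k r; have [[s es] [s' es']] := (tt k r, tu k r).
by exists (fEq s s') => H h e /=; rewrite es es'.
Qed.

(** A condition b that does not depend on the structure, such as the guard
i < j of a condition on a basis, is settled when the formula is chosen. *)
Lemma fo_const (b : Prop) : @first_order V (fun=> fun=> fun=> b).
Proof.
move=> k r; have [yb|nb] := pselect b.
  by exists (fNot (fFalse n k)) => H h e; split=> // _ [].
by exists (fFalse n k).
Qed.

Lemma fo_and P Q : first_order P -> first_order Q ->
  first_order (fun H h e => P H h e /\ Q H h e).
Proof.
move=> Pfo Qfo k r; have [[f fP] [g gQ]] := (Pfo k r, Qfo k r).
by exists (fAnd f g) => H h e /=; rewrite fP gQ.
Qed.

Lemma fo_imp P Q : first_order P -> first_order Q ->
  first_order (fun H h e => P H h e -> Q H h e).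
Proof.
move=> Pfo Qfo k r; have [[f fP] [g gQ]] := (Pfo k r, Qfo k r).
by exists (fImp f g) => H h e /=; rewrite fP gQ.
Qed.

Lemma fo_and3 P Q R :
  first_order P -> first_order Q -> first_order R ->
  first_order (fun H h e => [/\ P H h e, Q H h e & R H h e]).
Proof.
move=> Pfo Qfo Rfo; apply: fo_iff (fo_and Pfo (fo_and Qfo Rfo)) => H h e.
by split=> [[? []]|[]].
Qed.

Lemma fo_and4 P Q R S :
  first_order P -> first_order Q -> first_order R -> first_order S ->
  first_order (fun H h e => [/\ P H h e, Q H h e, R H h e & S H h e]).
Proof.
move=> Pfo Qfo Rfo Sfo; apply: fo_iff (fo_and Pfo (fo_and3 Qfo Rfo Sfo)).
by move=> H h e; split=> [[? []]|[]].
Qed.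

Lemma fo_not P : first_order P -> first_order (fun H h e => ~ P H h e).
Proof. by move=> Pfo; apply: fo_imp => //; apply: fo_const. Qed.

Lemma fo_all_fin (I : finType) (P : I -> rel_family V) :
  (forall i, first_order (P i)) ->
  first_order (fun H h e => forall i, P i H h e).
Proof.
move=> Pfo.
suff: first_order (fun H h e => forall i, i \in enum I -> P i H h e).
  by apply: fo_iff => H h e; split=> hP i => [|_]; apply: hP; rewrite ?mem_enum.
elim: (enum I) => [|i s IHs].
  by apply: (fo_iff _ (fo_const True)) => H h e; split.
apply: (fo_iff _ (fo_and (Pfo i) IHs)) => H h e; split.
  by move=> [Pi Ps] j; rewrite inE => /predU1P[->|/Ps].
by move=> Ps; split=> [|j js]; apply: Ps; rewrite inE ?eqxx ?js ?orbT.
Qed.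

End Connectives.

Definition term_lift k : term n k -> term n k.+1 :=
  fix lift_rec t := match t with
  | tVar i => tVar n (lift ord0 i)
  | tConst i => tConst k.+1 i
  | tOne => tOne n k.+1
  | tMul t1 t2 => tMul (lift_rec t1) (lift_rec t2)
  | tInv t1 => tInv (lift_rec t1)
  end.

Lemma eval_lift k (H : groupType) (h : 'I_n -> H) (e : 'I_k -> H) x t :
  eval h (econs x e) (term_lift t) = eval h e t.
Proof.
elim: t => //= [i|t1 -> t2 -> //|t1 -> //].
by rewrite /econs liftK.
Qed.

Lemma fo_all V
    (P : forall H : groupType, ('I_n -> H) -> (V -> H) -> H -> Prop) :
  first_order (fun H h (e : option V -> H) =>
    P H h (fun v => e (Some v)) (e None)) ->
  first_order (fun H h e => forall x, P H h e x).
Proof.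
move=> Pfo k r.
have [f fP] := Pfo _ (oapp (fun v => term_lift (r v)) (tVar n ord0)).
exists (fAll f) => H h e /=.
have fPx x : sat h f (econs x e) <-> P H h (fun v => eval h e (r v)) x.
  rewrite fP /= {2}/econs unlift_none.
  by under eq_fun do rewrite eval_lift.
by split=> hx x; apply/fPx.
Qed.

Lemma fo_ex V
    (P : forall H : groupType, ('I_n -> H) -> (V -> H) -> H -> Prop) :
  first_order (fun H h (e : option V -> H) =>
    P H h (fun v => e (Some v)) (e None)) ->
  first_order (fun H h e => exists x, P H h e x).
Proof.
move=> Pfo.
have := fo_not (fo_all (P := fun H h e x => ~ P H h e x) (fo_not Pfo)).
by apply: fo_iff => H h e; rewrite not_existsP.
Qed.

(** A quantifier over an m-tuple is m nested quantifiers: the head of the tuple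
becomes the new variable [None], and the tail is left to the induction. *)
Lemma fo_all_tuple m V
    (P : forall H : groupType, ('I_n -> H) -> (V -> H) -> ('I_m -> H) -> Prop) :
  first_order (fun H h (e : V + 'I_m -> H) =>
        P H h (fun v => e (inl v)) (fun i => e (inr i))) ->
  first_order (fun H h e => forall u, P H h e u).
Proof.
elim: m => [|m IHm] in V P *.
  (* There is one empty tuple; a dummy variable x names it as fun=> x. *)
  pose s (a : V + 'I_0) := if a is inl v then Some v else None.
  move=> /(fo_rename s) /(fo_all (P := fun H h e x => P H h e (fun=> x))).
  apply: fo_iff => H h e; split=> hP u; last exact: hP.
  by rewrite (_ : u = fun=> 1) //; apply/funext => -[].
pose s (a : V + 'I_m.+1) : option V + 'I_m := match a with
  | inl v => inl (Some v)
  | inr i => if unlift ord0 i is Some j then inr j else inl None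
  end.
move=> /(fo_rename s) Pfo.
apply: fo_iff (fo_all (P := fun H h e x => forall u, P H h e (econs x u)) _).
  move=> H h e; split=> [hP u|hP x u]; last exact: hP.
  rewrite (_ : u = econs (u ord0) (fun i => u (lift ord0 i))) //.
  by apply/funext => i; rewrite /econs; case: unliftP => [j|] ->.
apply: (IHm (option V) (fun H h e u =>
  P H h (fun v => e (Some v)) (econs (e None) u))).
apply: fo_iff Pfo => H h e /=.
rewrite (_ : (fun i => _) = econs (e (inl None)) (fun i => e (inr i))) //.
by apply/funext => i; rewrite /econs; case: unliftP.
Qed.

Lemma fo_all_fun (I : finType) V
    (P : forall H : groupType, ('I_n -> H) -> (V -> H) -> (I -> H) -> Prop) :
  first_order (fun H h (e : V + I -> H) =>
        P H h (fun v => e (inl v)) (fun i => e (inr i))) ->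
  first_order (fun H h e => forall u, P H h e u).
Proof.
pose s (a : V + I) : V + 'I_#|I| :=
  match a with inl v => inl v | inr i => inr (enum_rank i) end.
move=> /(fo_rename s) Pfo.
apply: fo_iff (fo_all_tuple (P := fun H h e u =>
  P H h e (fun i => u (enum_rank i))) Pfo) => H h e.
split=> [hP u|hP u]; last exact: hP.
rewrite (_ : u = fun i => u (enum_val (enum_rank i))).
  exact: hP (u \o enum_val).
by apply/funext => i; rewrite enum_rankK.
Qed.

Lemma fo_ex_fun (I : finType) V
    (P : forall H : groupType, ('I_n -> H) -> (V -> H) -> (I -> H) -> Prop) :
  first_order (fun H h (e : V + I -> H) =>
        P H h (fun v => e (inl v)) (fun i => e (inr i))) ->
  first_order (fun H h e => exists u, P H h e u).
Proof.
move=> Pfo.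
have := fo_not (fo_all_fun (P := fun H h e u => ~ P H h e u) (fo_not Pfo)).
by apply: fo_iff => H h e; rewrite not_existsP.
Qed.

Lemma fo_all_fun2 (I J : finType) V
    (P : forall H : groupType,
       ('I_n -> H) -> (V -> H) -> (I -> J -> H) -> Prop) :
  first_order (fun H h (e : V + (I * J) -> H) =>
        P H h (fun v => e (inl v)) (fun i j => e (inr (i, j)))) ->
  first_order (fun H h e => forall u, P H h e u).
Proof.
move=> /(fo_all_fun (P := fun H h e u => P H h e (fun i j => u (i, j)))).
by apply: fo_iff => H h e; split=> hP u; [exact: (hP (fun a => u a.1 a.2))|].
Qed.

Lemma fo_ex_fun2 (I J : finType) V
    (P : forall H : groupType,
       ('I_n -> H) -> (V -> H) -> (I -> J -> H) -> Prop) :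
  first_order (fun H h (e : V + (I * J) -> H) =>
        P H h (fun v => e (inl v)) (fun i j => e (inr (i, j)))) ->
  first_order (fun H h e => exists u, P H h e u).
Proof.
move=> Pfo.
have := fo_not (fo_all_fun2 (P := fun H h e u => ~ P H h e u) (fo_not Pfo)).
by apply: fo_iff => H h e; rewrite not_existsP.
Qed.

End Definability.

(** * Bases without quantification over subgroups *)

Lemma commute_commg (H : groupType) (x y : H) : commute x y <-> [~ x, y] = 1.
Proof. by split=> [/commgP/eqP|/eqP/commgP]. Qed.

Lemma centralizer_subgroup (H : groupType) (x : H) :
  is_subgroup (centralizer x).
Proof.
by split=> [|a b ca cb]; [exact: commute1 | apply/commuteM/commuteV].
Qed.

Lemma centralizerM (H : groupType) (x a b : H) :
  centralizer x a -> centralizer x b -> centralizer x (a * b).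
Proof. exact: commuteM. Qed.

Section Class2.
Variables (H : groupType) (cl2 : nil2 H).

Lemma commg_in_center (x y : H) : center H [~ x, y].
Proof. by have := commg_center cl2 x y; rewrite inE. Qed.

Lemma cl2_commMl (x y z : H) : [~ x * y, z] = [~ x, z] * [~ y, z].
Proof.
rewrite [LHS]commgEl conjMg invgM -mulgA (mulgA x^-1) -commgEl.
by rewrite mulgA -(commg_in_center x z y^-1) -mulgA -commgEl.
Qed.

Lemma cl2_commVl (x z : H) : [~ x^-1, z] = [~ x, z]^-1.
Proof.
by apply/eqP; rewrite -mulg_eq1 -cl2_commMl mulVg comm1g.
Qed.

Lemma cl2_commMr (x y z : H) : [~ z, x * y] = [~ z, x] * [~ z, y].
Proof.
by rewrite -[LHS]invgR cl2_commMl invgM !invgR (commg_in_center z y).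
Qed.

Lemma cl2_commVr (x z : H) : [~ z, x^-1] = [~ z, x]^-1.
Proof. by rewrite -[LHS]invgR cl2_commVl invgR. Qed.

(** By [cl2_commMr] the commutators [~ x, c] with c in K already form a
subgroup; this is what makes [h_i, H_j] definable by an existential formula. *)
Lemma commutator_set1l (x : H) (K : set H) : is_subgroup K ->
  commutator [set x] K = [set [~ x, c] | c in K].
Proof.
move=> [K1 KF]; apply/seteqP; split.
  apply: smallest_sub => [|_ [a /= ->] [c Kc <-]]; last by exists c.
  split=> [|_ _ [c Kc <-] [d Kd <-]]; first by exists 1; rewrite ?commg1.
  by exists (c / d); [exact: KF | rewrite cl2_commMr cl2_commVr].
by move=> _ [c Kc <-]; apply: sub_gen_smallest; exists x => //; exists c.
Qed.

Lemma commutator_set1r (x : H) (K : set H) : is_subgroup K ->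
  commutator K [set x] = [set [~ c, x] | c in K].
Proof.
move=> [K1 KF]; apply/seteqP; split.
  apply: smallest_sub => [|_ [c Kc] [a /= -> <-]]; last by exists c.
  split=> [|_ _ [c Kc <-] [d Kd <-]]; first by exists 1; rewrite ?comm1g.
  by exists (c / d); [exact: KF | rewrite cl2_commMl cl2_commVl].
by move=> _ [c Kc <-]; apply: sub_gen_smallest; exists c => //; exists x.
Qed.

End Class2.

Lemma commutator_sub (H : groupType) (A B K : set H) : is_subgroup K ->
  (forall a b, A a -> B b -> K [~ a, b]) -> commutator A B `<=` K.
Proof.
move=> sK AB; apply: smallest_sub => // _ [a Aa] [b Bb <-]; exact: AB.
Qed.

Lemma mem_commutator (H : groupType) (A B : set H) a b : A a -> B b ->
  commutator A B [~ a, b].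
Proof. by move=> Aa Bb; apply: sub_gen_smallest; exists a => //; exists b. Qed.

Lemma commutator_subgroup (H : groupType) (A B : set H) :
  is_subgroup (commutator A B).
Proof.
split=> [K [[K1 _] _]|x y Kx Ky K] //= CK; have [[_ KF] _] := CK.
by apply: KF; [exact: (Kx K CK) | exact: (Ky K CK)].
Qed.

Lemma center_subgroup (H : groupType) : is_subgroup (center H).
Proof. by split=> [|x y]; [exact: center1 | exact: centerF]. Qed.

Section ElementaryBasis.
Variables (n : nat) (H : groupType) (h : 'I_n -> H).

(** The subgroup [h_i, H_j], and so H_ij, in a basis. *)
Definition bracket_set (i j : 'I_n) : set H :=
  [set [~ h i, c] | c in centralizer (h j)].

(** The conditions of a basis with every subgroup eliminated.  The second
clause carries the equalities H_ij = [h_i, H_j] = [H_i, h_j] = [H_i, H_j]: the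
first two groups are contained in the third, and the clause gives the two
opposite inclusions on generators. *)
Definition basis_axioms : Prop :=
  [/\ forall x y z : H, commute [~ x, y] z,
      forall i j : 'I_n, i < j -> forall x y,
        centralizer (h i) x -> centralizer (h j) y ->
        (exists c, centralizer (h j) c /\ [~ x, y] = [~ h i, c]) /\
        (exists c, centralizer (h i) c /\ [~ x, y] = [~ c, h j]),
      forall i j : 'I_n, i < j -> forall x,
        centralizer (h i) x -> centralizer (h j) x -> center H x &
      forall i x y, centralizer (h i) x -> centralizer (h i) y -> commute x y]
  /\
  [/\ forall x : H, exists u v,
        [/\ forall i, centralizer (h i) (u i), center H v
          & x = rev_prod u * v],
      forall u u' v v',
        (forall i, centralizer (h i) (u i)) ->
        (forall i, centralizer (h i) (u' i)) ->
        center H v -> center H v' ->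
        rev_prod u * v = rev_prod u' * v' ->
        forall i, center H ((u i)^-1 * u' i),
      forall v, center H v -> exists u,
        (forall i j : 'I_n, i < j -> bracket_set i j (u i j)) /\
        v = upper_prod u &
      forall v, center H v -> forall u u',
        (forall i j : 'I_n, i < j -> bracket_set i j (u i j)) ->
        (forall i j : 'I_n, i < j -> bracket_set i j (u' i j)) ->
        v = upper_prod u -> v = upper_prod u' ->
        forall i j : 'I_n, i < j -> u i j = u' i j].

Lemma basis_axioms_nil2 : basis_axioms -> nil2 H.
Proof.
case=> [[comm _ _ _] _].
by apply: commutator_sub => [|x y _ _ z]; [exact: center_subgroup|exact: comm].
Qed.

Lemma commutator_bracket_set (i j : 'I_n) : basis_axioms -> i < j ->
  commutator (centralizer (h i)) (centralizer (h j)) = bracket_set i j.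
Proof.
move=> bh ij; have cl2 := basis_axioms_nil2 bh; have [[_ fib _ _] _] := bh.
have bracketE : bracket_set i j = commutator [set h i] (centralizer (h j)).
  by rewrite commutator_set1l //; exact: centralizer_subgroup.
apply/seteqP; split.
  apply: commutator_sub => [|x y cx cy].
    by rewrite bracketE; exact: commutator_subgroup.
  by have [[c [cc ->]] _] := fib i j ij x y cx cy; exists c.
by move=> _ [c cc <-]; apply: mem_commutator.
Qed.

(** The centre is contained in [H, H] because each central element is a product
of commutators [h_i, c]. *)
Lemma derived_center : basis_axioms ->
  commutator [set: H] [set: H] = center H.
Proof.
move=> bh; apply/seteqP; split; first exact: basis_axioms_nil2 bh.
have [_ [_ _ dec _]] := bh; move=> v /dec[u [fu ->]].
have [K1 KF] := commutator_subgroup [set: H] [set: H].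
have KM x y : commutator [set: H] [set: H] x ->
    commutator [set: H] [set: H] y -> commutator [set: H] [set: H] (x * y).
  move=> Kx Ky; have := KF _ _ Kx (KF _ _ K1 Ky); by rewrite div1g invgK.
rewrite /upper_prod; apply: big_ind => // i _; apply: big_ind => // j ij.
by have [c _ <-] := fu i j ij; apply: mem_commutator.
Qed.

Lemma basis_conditionsP :
  (exists S S2, basis_conditions h S S2) <-> basis_axioms.
Proof.
split=> [[S [S2 b]]|].
  have cl2 := basis_class2 b.
  have eS : S = fun i => centralizer (h i).
    by apply/funext => i; exact: basis_cent b i.
  subst S.
  have S2E (i j : 'I_n) : i < j -> S2 i j = bracket_set i j.
    move=> ij; rewrite (basis_comml b ij) commutator_set1l //.
    exact: centralizer_subgroup.
  have S2P (u : 'I_n -> 'I_n -> H) :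
      (forall i j : 'I_n, i < j -> S2 i j (u i j)) <->
      (forall i j : 'I_n, i < j -> bracket_set i j (u i j)).
    by split=> hu i j ij; have := hu i j ij; rewrite S2E.
  split; split.
  - by move=> x y z; exact: commg_in_center.
  - move=> i j ij x y cx cy.
    have S2xy : S2 i j [~ x, y].
      by rewrite (basis_comm b ij); exact: mem_commutator.
    split.
      by move: S2xy; rewrite S2E // => -[c cc ec]; exists c.
    move: S2xy; rewrite (basis_commr b ij) commutator_set1r //; last first.
      exact: centralizer_subgroup.
    by case=> c cc ec; exists c.
  - by move=> i j ij x xi xj; rewrite -(basis_capI b ij).
  - move=> i x y xi yi; apply/commute_commg.
    have := mem_commutator xi yi; by rewrite (basis_abelian b).
  - exact: basis_decomp b.
  - exact: basis_decomp_uniq b.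
  - move=> v Zv; have [u [Su ev]] := basis_decomp2 b Zv.
    by exists u; split=> //; apply/S2P.
  - move=> v Zv u u' /S2P Su /S2P Su'.
    exact: basis_decomp2_uniq b _ Zv _ _ Su Su'.
move=> bh; have [[_ a2 a3 a4] [a5 a6 a7 a8]] := bh.
have cl2 := basis_axioms_nil2 bh.
have sC i := centralizer_subgroup (h i).
have bracketE i j : bracket_set i j = commutator [set h i] (centralizer (h j)).
  by rewrite commutator_set1l.
have commE (i j : 'I_n) : i < j ->
    bracket_set i j = commutator (centralizer (h i)) (centralizer (h j)).
  by move=> ij; rewrite commutator_bracket_set.
exists (fun i => centralizer (h i)), bracket_set; split=> //.
- by move=> i j ij; rewrite bracketE; exact: commutator_subgroup.
- move=> i j ij; rewrite commE //; apply/seteqP; split; last first.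
    apply: commutator_sub => [|x _ cx ->]; first exact: commutator_subgroup.
    exact: mem_commutator.
  apply: commutator_sub => [|x y cx cy]; first exact: commutator_subgroup.
  have [_ [c [cc ->]]] := a2 i j ij x y cx cy; exact: mem_commutator.
- move=> i j ij; apply/seteqP; split=> [x [xi xj]|x xZ].
    exact: a3 ij x xi xj.
  by split; apply/commute_sym/xZ.
- move=> i; apply/seteqP; split.
    apply: commutator_sub => [|x y cx cy].
      by split=> [|x y -> ->] //=; rewrite divg1.
    by apply/commute_commg; exact: (a4 i x y cx cy).
  by move=> _ ->; exact: (commutator_subgroup _ _).1.
Qed.

End ElementaryBasis.

(** * Elements of P(f_H) as tuples of group elements *)

Section UpperProd.
Variables (n : nat) (H : groupType).

Lemma upper_prodM (u u' : 'I_n -> 'I_n -> H) :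
  (forall i j, center H (u i j)) ->
  upper_prod (fun i j => u i j * u' i j) = upper_prod u * upper_prod u'.
Proof.
move=> Zu; rewrite /upper_prod -prodgM_commute => [|i j _ _].
  by apply: eq_bigr => i _; rewrite prodgM_commute // => j k _ _; exact: Zu.
by apply/commute_sym/commute_prod => k _; apply/commute_sym/Zu.
Qed.

Lemma upper_prod1 (k l : 'I_n) (x : H) : k < l ->
  upper_prod (fun i j => if (i == k) && (j == l) then x else 1) = x.
Proof.
move=> kl; rewrite /upper_prod (big_only1 k) //=; last first.
  by move=> i /negPf -> _; rewrite big1.
rewrite (big_only1 l) ?eqxx //.
by move=> j /negPf ->.
Qed.

Lemma upper_prod_center (u : 'I_n -> 'I_n -> H) :
  (forall i j, center H (u i j)) -> center H (upper_prod u).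
Proof.
move=> Zu; rewrite /upper_prod.
apply: big_ind => [|x y|i _]; [exact: center1|exact: centerM|].
by apply: big_ind => [|x y|j _]; [exact: center1|exact: centerM|].
Qed.

Lemma eq_upper_prod (u u' : 'I_n -> 'I_n -> H) :
  (forall i j : 'I_n, i < j -> u i j = u' i j) -> upper_prod u = upper_prod u'.
Proof. by move=> uu'; do 2![apply: eq_bigr => ? *]; apply: uu'. Qed.

End UpperProd.

Lemma hom_of_graph (G K : groupType) (R : G -> K -> Prop) :
  (forall x, exists y, R x y) ->
  (forall x y y', R x y -> R x y' -> y = y') ->
  (forall x x' y y', R x y -> R x' y' -> R (x * x') (y * y')) ->
  exists phi : {multiplicative G -> K}, forall x, R x (phi x).
Proof.
move=> Rtot Rfun RM; have [f fR] := choice Rtot.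
have fM : {morph f : x y / x * y}.
  by move=> x y; apply: Rfun (fR _) _; apply: RM.
pose mM := isMultiplicative.Build G K f fM.
pose phi : {multiplicative G -> K} := HB.pack f mM.
by exists phi.
Qed.

Section Multiplicative.
Variables (G K : groupType) (phi : {multiplicative G -> K}).

Lemma multiplicative1 : phi 1 = 1.
Proof. by apply: (mulgI (phi 1)); rewrite -gmulfM !mulg1. Qed.

Lemma multiplicativeV x : phi x^-1 = (phi x)^-1.
Proof.
by apply: (mulgI (phi x)); rewrite -gmulfM !mulgV multiplicative1.
Qed.

End Multiplicative.

Section CommutatorForm.
Variables (H : groupType) (cl2 : nil2 H).
Local Notation f_H := (f_H cl2).

Lemma center_valM (a b : center_of H) : val (a * b) = val a * val b.
Proof. exact: gmulfM. Qed.

Lemma center_valV (a : center_of H) : val a^-1 = (val a)^-1.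
Proof. exact: gmulfV. Qed.

Lemma center_val1 : val (1 : center_of H) = 1.
Proof. exact: gmulf1. Qed.

Lemma coset_surj (u : center_quot H) : exists x, u = coset x.
Proof. by exists (repr u); rewrite /coset reprK. Qed.

Lemma f_HMl u v w : f_H (u * v) w = f_H u w * f_H v w.
Proof.
move: u v w; elim/cosetW=> x; elim/cosetW=> y; elim/cosetW=> z; apply: val_inj.
by rewrite center_valM -cosetM !f_HE cl2_commMl.
Qed.

Lemma f_HMr u v w : f_H u (v * w) = f_H u v * f_H u w.
Proof.
move: u v w; elim/cosetW=> x; elim/cosetW=> y; elim/cosetW=> z; apply: val_inj.
by rewrite center_valM -cosetM !f_HE cl2_commMr.
Qed.

Lemma f_HV u w : (f_H u w)^-1 = f_H w u.
Proof.
move: u w; elim/cosetW=> x; elim/cosetW=> y; apply: val_inj.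
by rewrite center_valV !f_HE invgR.
Qed.

Lemma f_H_eq1 x y : f_H (coset x) (coset y) = 1 <-> commute x y.
Proof.
rewrite commute_commg -(f_HE cl2); split=> [->|e]; first exact: center_val1.
by apply: val_inj; rewrite e center_val1.
Qed.

Lemma f_H_eq a b c d :
  f_H (coset a) (coset b) = f_H (coset c) (coset d) <-> [~ a, b] = [~ c, d].
Proof. by rewrite -!(f_HE cl2); split=> [->|/val_inj]. Qed.

End CommutatorForm.

Section Multipliers.
Variables (n : nat) (H : groupType) (h : 'I_n -> H).

(** With y_k standing for phi(h_k), these are the equations that
self-adjointness f(h_k, phi w) = f(phi h_k, w) imposes on w' = phi w. *)
Definition multiplier_graph (y : 'I_n -> H) (w w' : H) : Prop :=
  forall k, [~ h k, w'] = [~ y k, w].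

(** The last clause makes [a, b] |-> [phi a, b] well defined on commutators.  It
also yields self-adjointness, as [a, b] = [b^-1, a]. *)
Definition multiplier (y : 'I_n -> H) : Prop :=
  [/\ forall k, multiplier_graph y (h k) (y k),
      forall w, exists w', multiplier_graph y w w' &
      forall a a' b c c' d,
        multiplier_graph y a a' -> multiplier_graph y c c' ->
        [~ a, b] = [~ c, d] -> [~ a', b] = [~ c', d]].

Definition cyclicity_axiom : Prop :=
  forall i x, centralizer (h i) x -> exists y, multiplier y /\ y i = x.

Hypotheses (n_ge2 : 2 <= n) (bh : basis_axioms h) (cl2 : nil2 H).

(** Since n >= 2 there are two distinct basis elements, whose centralizers meet
in the centre. *)
Lemma centralizers_center x : (forall i, centralizer (h i) x) -> center H x.
Proof.
case: bh => [[_ _ cap _] _] cx.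
have i0 : 0 < n by apply: ltnW.
exact: (cap (Ordinal i0) (Ordinal n_ge2)).
Qed.

Lemma basis_ind (P : H -> Prop) :
  (forall x y, P x -> P y -> P (x * y)) ->
  (forall i x, centralizer (h i) x -> P x) -> forall x, P x.
Proof.
have i0 : 0 < n by apply: ltnW.
move=> PM PC x; have [_ [/(_ x)[u [v [cu Zv ->]]] _ _ _]] := bh.
apply: (PM); last by apply: (PC (Ordinal i0)); apply/commute_sym/Zv.
apply: big_ind => // [|i _]; last exact: PC (cu _).
by apply: (PC (Ordinal i0)); exact: commute1.
Qed.

Section OfMultiplier.
Variable y : 'I_n -> H.
Local Notation multiplier_graph := (multiplier_graph y).

Lemma graph1 : multiplier_graph 1 1.
Proof. by move=> k; rewrite !commg1. Qed.

Lemma graphM a a' b b' :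
  multiplier_graph a a' -> multiplier_graph b b' ->
  multiplier_graph (a * b) (a' * b').
Proof. by move=> ga gb k; rewrite !cl2_commMr // ga gb. Qed.

(** The difference of two possible images commutes with every h_k, hence is
central. *)
Lemma graph_coset a a' b b' : multiplier_graph a a' -> multiplier_graph b b' ->
  coset a = coset b -> coset a' = coset b'.
Proof.
move=> ga gb /center_quotP Zab; apply/center_quotP/centralizers_center => k.
apply/commute_commg; rewrite cl2_commMr // cl2_commVr // ga gb.
by rewrite -cl2_commVr // -cl2_commMr //; apply/commute_commg/commute_sym/Zab.
Qed.

Hypothesis My : multiplier y.

Lemma multiplier_quot :
  exists phi : {multiplicative center_quot H -> center_quot H},
  forall a a', multiplier_graph a a' -> phi (coset a) = coset a'.
Proof.
have [_ gtot _] := My.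
pose R u u' :=
  exists a a', [/\ u = coset a, u' = coset a' & multiplier_graph a a'].
have [|||phi phiR] := @hom_of_graph (center_quot H) (center_quot H) R.
- move=> u; have [a ->] := coset_surj u; have [a' ga] := gtot a.
  by exists (coset a'), a, a'.
- move=> u v v' [a [a' [-> -> ga]]] [b [b' [eab -> gb]]].
  exact: graph_coset ga gb eab.
- move=> u v u' v' [a [a' [-> -> ga]]] [b [b' [-> -> gb]]].
  exists (a * b), (a' * b'); rewrite !cosetM; split=> //; exact: graphM.
exists phi => a a' ga; have [b [b' [eab -> gb]]] := phiR (coset a).
exact/esym/(graph_coset ga gb eab).
Qed.

(** An element [h_k, c] of H_kl, with c in H_l, goes to [y_k, c], which the
multiplier property makes independent of c; uniqueness of the decomposition
of central elements over the H_kl extends this to Z(H). *)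
Lemma multiplier_center :
  exists phi : {multiplicative center_of H -> center_of H},
  forall (k l : 'I_n) c z, k < l -> centralizer (h l) c -> val z = [~ h k, c] ->
    val (phi z) = [~ y k, c].
Proof.
have [gh _ gcomm] := My.
have [_ [_ _ dec dec_uniq]] := bh.
(* The graph of phi_0: apply [h_k, c] |-> [y_k, c] in each factor H_kl. *)
pose R (z z' : center_of H) := exists c : 'I_n -> 'I_n -> H,
  [/\ forall k l, centralizer (h l) (c k l),
      val z = upper_prod (fun k l => [~ h k, c k l]) &
      val z' = upper_prod (fun k l => [~ y k, c k l])].
have ZC a b := commg_in_center cl2 a b.
have Zval (z : center_of H) : center H (val z) by have := valP z; rewrite inE.
have Rfun z z1 z2 : R z z1 -> R z z2 -> z1 = z2.
  move=> [c [cc ec ez1]] [d [cd ed ez2]]; apply: val_inj; rewrite ez1 ez2.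
  apply: eq_upper_prod => k l kl; apply: gcomm (gh k) (gh k) _.
  have := @dec_uniq (val z) (Zval z) _ _ _ _ ec ed k l kl; apply=> i j _.
    by exists (c i j).
  by exists (d i j).
have R1 (k l : 'I_n) c z z' : k < l -> centralizer (h l) c ->
    val z = [~ h k, c] -> val z' = [~ y k, c] -> R z z'.
  move=> kl cc ez ez'.
  exists (fun i j => if (i == k) && (j == l) then c else 1); split.
  - by move=> i j; case: andP => [[_ /eqP->] //|_]; exact: commute1.
  - rewrite ez -[LHS](upper_prod1 _ kl); apply: eq_upper_prod => i j _.
    by case: andP => [[/eqP-> _] //|_]; rewrite commg1.
  - rewrite ez' -[LHS](upper_prod1 _ kl); apply: eq_upper_prod => i j _.
    by case: andP => [[/eqP-> _] //|_]; rewrite commg1.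
have mkC x : center H x -> exists z : center_of H, val z = x.
  move=> Zx; have Zx' : x \in center H by rewrite inE.
  by exists (Sub x Zx'); rewrite SubK.
have [|//||phi phiR] := @hom_of_graph (center_of H) (center_of H) R.
- move=> z; have [u [fu ez]] := dec _ (Zval z).
  have /choice[c cP] (kl : 'I_n * 'I_n) : exists c, centralizer (h kl.2) c /\
      (kl.1 < kl.2 -> u kl.1 kl.2 = [~ h kl.1, c]).
    have [/fu[c cc ec]|_] := boolP (kl.1 < kl.2).
      by exists c; split=> //; rewrite ec.
    by exists 1; split=> //; exact: commute1.
  have [z' ez'] := mkC _ (upper_prod_center (fun k l => ZC (y k) (c (k, l)))).
  exists z', (fun k l => c (k, l)); split=> // [k l|].
    by case: (cP (k, l)).
  by rewrite ez; apply: eq_upper_prod => k l kl; case: (cP (k, l)) => _ /(_ kl).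
- move=> z1 z2 z1' z2' [c [cc ez1 ez1']] [d [cd ez2 ez2']].
  exists (fun k l => c k l * d k l); split.
  - by move=> k l; apply: centralizerM.
  - rewrite center_valM ez1 ez2 -upper_prodM //.
    by apply: eq_upper_prod => k l _; rewrite cl2_commMr.
  - rewrite center_valM ez1' ez2' -upper_prodM //.
    by apply: eq_upper_prod => k l _; rewrite cl2_commMr.
exists phi => k l c z kl cc ez; have [z' ez'] := mkC _ (ZC (y k) c).
by rewrite -ez'; congr val; apply: Rfun (phiR z) _; exact: R1 kl cc ez ez'.
Qed.

(** Both phi_0 [a, b] and [phi_1 a, b] are bilinear in a and b and the
centralizers H_k generate H, so they only have to be compared for a in H_k and
b in H_l. *)
Lemma multiplier_P_f : exists2 phi, P_f cl2 phi &
  forall k, phi.1 (coset (h k)) = coset (y k).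
Proof.
have [phi1 phi1E] := multiplier_quot; have [phi0 phi0E] := multiplier_center.
have [gh gtot gcomm] := My.
have [[_ fib _ ab] _] := bh.
have key u w : phi0 (f_H cl2 u w) = f_H cl2 (phi1 u) w.
  have [a ->] := coset_surj u; have [b ->] := coset_surj w.
  elim/basis_ind: a => [a1 a2 IH1 IH2|k a ca].
    by rewrite cosetM gmulfM !f_HMl gmulfM IH1 IH2.
  elim/basis_ind: b => [b1 b2 IH1 IH2|l b cb].
    by rewrite cosetM !f_HMr gmulfM IH1 IH2.
  have [a' ga] := gtot a; rewrite (phi1E a a') //; apply: val_inj.
  have phi0K (p q : 'I_n) c : p < q -> centralizer (h q) c ->
      [~ a, b] = [~ h p, c] ->
      val (phi0 (f_H cl2 (coset a) (coset b))) =
      val (f_H cl2 (coset a') (coset b)).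
    move=> pq cc e; rewrite (phi0E p q c) ?f_HE //.
    by apply/esym; exact: gcomm ga (gh p) e.
  have [kl|lk|ekl] := ltngtP k l.
  - by have [[c [cc e]] _] := fib k l kl a b ca cb; exact: phi0K kl cc e.
  (* [a, b] = [b^-1, a] brings the smaller index to the left. *)
  - have cVb : centralizer (h l) b^-1 by exact: commuteV.
    have [[c [cc e]] _] := fib l k lk b^-1 a cVb ca.
    by apply: phi0K lk cc _; rewrite -e cl2_commVl // invgR.
  (* H_k is abelian, so [a, b] = [1, 1], and hence [a', b] = [1, 1]. *)
  - move: cb; rewrite -(val_inj ekl) => cb.
    have cab := ab _ _ _ ca cb.
    rewrite (_ : f_H _ _ _ = 1); last exact/f_H_eq1.
    rewrite multiplicative1 center_val1 f_HE -(commg1 1).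
    apply/esym/(gcomm _ _ _ _ _ _ ga graph1).
    by rewrite commg1; apply/commute_commg.
exists (phi1, phi0) => [u w|k] /=; last exact: phi1E.
by rewrite -key -[f_H _ u w]f_HV multiplicativeV key f_HV.
Qed.

End OfMultiplier.

(** The relation [multiplier_graph y] is exactly the graph of phi_1 modulo the
centre, which turns each clause into an identity of P(f_H). *)
Lemma P_f_multiplier phi (y : 'I_n -> H) : P_f cl2 phi ->
  (forall k, coset (y k) = phi.1 (coset (h k))) -> multiplier y.
Proof.
move=> Pphi ey.
have gE w w' : multiplier_graph y w w' <-> coset w' = phi.1 (coset w).
  have ye k : [~ y k, w] = val (f_H cl2 (coset (h k)) (phi.1 (coset w))).
    by rewrite -(f_HE cl2) ey (Pphi _ _).1.
  have [v ev] := coset_surj (phi.1 (coset w)).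
  have {}ye k : [~ y k, w] = [~ h k, v] by rewrite ye ev f_HE.
  rewrite ev; split=> [gw|/center_quotP Zwv k].
    apply/center_quotP/centralizers_center => k; apply/commute_commg.
    by rewrite cl2_commMr // cl2_commVr // gw ye mulVg.
  rewrite ye -[v](mulVKg w') cl2_commMr //.
  rewrite [X in _ * X](_ : _ = 1) ?mulg1 //.
  by apply/commute_commg/commute_sym/Zwv.
split=> [k|w|a a' b c c' d /gE ea /gE ec].
- by apply/gE; rewrite ey.
- by have [w' ew'] := coset_surj (phi.1 (coset w)); exists w'; apply/gE.
move=> /(f_H_eq cl2) e; apply/(f_H_eq cl2); rewrite ea ec.
by rewrite !(Pphi _ _).1 !(Pphi _ _).2 e.
Qed.

(** Commutation with h_i follows from
f(h_i, phi h_i) = phi_0 (f(h_i, h_i)) = phi_0 1 = 1. *)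
Lemma P_f_cyclic_centralizer i :
  P_f_cyclic cl2 (coset (h i)) `<=` [set coset x | x in centralizer (h i)].
Proof.
move=> _ [phi Pphi <-]; have [x ex] := coset_surj (phi.1 (coset (h i))).
exists x => //; apply/(f_H_eq1 cl2); rewrite -ex (Pphi _ _).2.
by rewrite (_ : f_H _ _ _ = 1) ?multiplicative1 //; apply/f_H_eq1.
Qed.

Lemma cyclicity_axiomP : cyclicity_axiom <->
  forall i, [set coset x | x in centralizer (h i)] =
            P_f_cyclic cl2 (coset (h i)).
Proof.
split=> [cyc i|cyc i x cx].
  apply/seteqP; split; last exact: P_f_cyclic_centralizer.
  move=> _ [x cx <-]; have [y [My <-]] := cyc i x cx.
  by have [phi Pphi phiE] := multiplier_P_f My; exists phi.
have [phi Pphi phix] : P_f_cyclic cl2 (coset (h i)) (coset x).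
  by rewrite -cyc; exists x.
exists (fun k => if k == i then x else repr (phi.1 (coset (h k)))).
split; last by rewrite eqxx.
apply: (P_f_multiplier Pphi) => k; case: eqP => [->//|_].
by rewrite /coset reprK.
Qed.

End Multipliers.

(** * Definability of the axioms *)

Section FormulasForBases.
Variable n : nat.

Section Atoms.
Variable V : Type.
Implicit Types t u : elem_family n V.

Lemma fo_commute t u : is_term t -> is_term u ->
  first_order (fun H h e => commute (t H h e) (u H h e)).
Proof. by move=> tt tu; apply: fo_eq; apply: term_mul. Qed.

Lemma fo_centralizer i t : is_term t ->
  first_order (fun H h e => centralizer (h i) (t H h e)).
Proof. by move=> tt; apply: fo_commute => //; apply: term_const. Qed.

End Atoms.

Lemma is_term_weaken V (t : elem_family n V) : is_term t ->
  is_term (fun H h (e : option V -> H) => t H h (fun v => e (Some v))).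
Proof. by move=> tt k r; have [s es] := tt k (r \o Some); exists s. Qed.

Lemma fo_center V (t : elem_family n V) : is_term t ->
  first_order (fun H h e => center H (t H h e)).
Proof.
move=> tt; change (first_order (fun H h e => forall x, commute (t H h e) x)).
apply: fo_all; apply: fo_commute; last exact: term_var.
exact: is_term_weaken.
Qed.

Lemma fo_bracket_set V i j (t : elem_family n V) : is_term t ->
  first_order (fun H h e => bracket_set h i j (t H h e)).
Proof.
move=> tt; suff: first_order (fun H h e =>
    exists c, centralizer (h j) c /\ t H h e = [~ h i, c]).
  by apply: fo_iff => H h e; split=> -[c]; [case|]; exists c.
apply/fo_ex/fo_and; first exact/fo_centralizer/term_var.
apply: fo_eq; first exact: is_term_weaken.
by apply: term_commg; [exact: term_const|exact: term_var].
Qed.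

Ltac fo_term := solve [repeat first
  [ apply: term_var | apply: term_const
  | apply: term_commg | apply: term_prod => ? | apply: term_mul
  | apply: term_inv ]].

Ltac fo_auto := repeat first
  [ apply: fo_center; fo_term | apply: fo_centralizer; fo_term
  | apply: fo_bracket_set; fo_term | apply: fo_commute; fo_term
  | apply: fo_eq; fo_term
  | apply: fo_and4 | apply: fo_and3 | apply: fo_and
  | apply: fo_all | apply: fo_ex | apply: fo_all_fun | apply: fo_ex_fun
  | apply: fo_all_fun2 | apply: fo_ex_fun2
  | apply: fo_const
  | apply: fo_all_fin => ? | apply: fo_imp ].

Lemma fo_basis_axioms V :
  first_order (fun H h (_ : V -> H) => @basis_axioms n H h).
Proof.
rewrite /basis_axioms /upper_prod /rev_prod.
fo_auto.
Qed.

Lemma fo_cyclicity_axiom V :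
  first_order (fun H h (_ : V -> H) => @cyclicity_axiom n H h).
Proof.
rewrite /cyclicity_axiom /multiplier /multiplier_graph.
fo_auto.
Qed.

End FormulasForBases.

Lemma definable_of_fo n (S : forall H : groupType, ('I_n -> H) -> set H) :
  first_order (fun H h (e : 'I_1 -> H) => S H h (e ord0)) ->
  definable_in_bases S.
Proof.
move=> /(_ 1%N (@tVar n 1))[f fS]; exists f => H h _.
by apply/seteqP; split=> x /fS.
Qed.

Lemma sentence_of_fo n (P : forall H : groupType, ('I_n -> H) -> Prop) :
  first_order (fun H h (_ : 'I_0 -> H) => P H h) ->
  exists s : sentence n, forall (H : groupType) (h : 'I_n -> H),
    models h s <-> P H h.
Proof. by move=> /(_ 0 (@tVar n 0))[s sP]; exists s => H h; exact: sP. Qed.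

Lemma definable_eq n (S S' : forall H : groupType, ('I_n -> H) -> set H) :
  (forall H h, is_basis h -> S H h = S' H h) ->
  definable_in_bases S -> definable_in_bases S'.
Proof. by move=> SS' [f fS]; exists f => H h bh; rewrite fS // SS'. Qed.

Theorem lemma6p7 (n : nat) (n_ge2 : 2 <= n) :
  [/\ definable_in_bases (fun (H : groupType) (_ : 'I_n -> H) => center H),
      forall i : 'I_n, definable_in_bases
        (fun (H : groupType) (h : 'I_n -> H) => centralizer (h i)),
      forall i j : 'I_n, i < j -> definable_in_bases
        (fun (H : groupType) (h : 'I_n -> H) =>
           commutator (centralizer (h i)) (centralizer (h j))),
      definable_in_bases
        (fun (H : groupType) (_ : 'I_n -> H) =>
           commutator (@setT H) (@setT H)) &
      (exists Sigma : seq (sentence n),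
         forall (H : groupType) (h : 'I_n -> H), distinct_nontrivial h ->
           (is_basis h <-> models_all h Sigma)) /\
      (exists s : sentence n,
         forall (H : groupType) (h : 'I_n -> H), is_basis h ->
           (is_P_f_basis h <-> models h s))].
Proof.
have axs (H : groupType) (h : 'I_n -> H) : is_basis h -> basis_axioms h.
  by case=> _ /basis_conditionsP.
have center_def : definable_in_bases
    (fun (H : groupType) (_ : 'I_n -> H) => center H).
  exact/definable_of_fo/fo_center/term_var.
split=> //.
- by move=> i; exact/definable_of_fo/fo_centralizer/term_var.
- move=> i j ij.
  apply: (@definable_eq _ (fun H h => bracket_set h i j)).
    by move=> H h /axs bh; rewrite commutator_bracket_set.
  exact/definable_of_fo/fo_bracket_set/term_var.
- by apply: definable_eq center_def => H h /axs /derived_center.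
split.
  have [s sP] := sentence_of_fo (@fo_basis_axioms n 'I_0).
  exists [:: s] => H h dh; split=> [/axs bh|[/sP bh _]].
    by split=> //; apply/sP.
  by split=> //; apply/basis_conditionsP.
have [s sP] := sentence_of_fo (@fo_cyclicity_axiom n 'I_0).
exists s => H h bh; rewrite sP; split=> [[b eb]|cyc].
  exact/(cyclicity_axiomP n_ge2 (axs _ _ b) (basis_nil2 b)).
by exists bh; apply/(cyclicity_axiomP n_ge2 (axs _ _ bh) (basis_nil2 bh)).
Qed.
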